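(* The mapping $\widehat{\phi}=\Phi_{\mathrm{SZ}}^{-1}\circ\widehat{\theta}\circ\Phi_{\mathrm{SZ}}$ is closed on the set of Baxter permutations, i.e. for every $n\ge1$ it maps $\mathfrak{S}_n(3\underline{14}2,2\underline{41}3)$ into itself. Consequently, for all $n\ge 1$, $$\sum_{\pi\in\mathfrak{S}_n(3\underline{14}2,2\underline{41}3)}q^{\underline{31}2(\pi)}r^{2\underline{13}(\pi)}s^{2\underline{31}(\pi)}=\sum_{\pi\in\mathfrak{S}_n(3\underline{14}2,2\underline{41}3)}q^{\underline{31}2(\pi)}r^{2\underline{31}(\pi)}s^{2\underline{13}(\pi)}.$$
   Context: $\mathfrak{S}_n$ is the set of permutations $\sigma=\sigma_1\cdots\sigma_n$ of $[n]=\{1,\dots,n\}$; $\sigma^{-1}_\ell$ denotes the position of the letter $\ell$ in $\sigma$. An occurrence of a vincular pattern in $\sigma$ is a subsequence of $\sigma$ order-isomorphic to the pattern in which the entries corresponding to the underlined letters occupy adjacent positions of $\sigma$. $\mathfrak{S}_n(3\underline{14}2,2\underline{41}3)$ is the set of Baxter permutations, i.e. those $\sigma\in\mathfrak{S}_n$ containing no occurrence of $3\underline{14}2$ and no occurrence of $2\underline{41}3$. Vincular pattern statistics: for $1\le \ell\le n$ let - $2\underline{13}(\ell,\sigma)=\#\{j:\sigma^{-1}_\ell<j<n,\ \sigma_j<\ell<\sigma_{j+1}\}$, - $2\underline{31}(\ell,\sigma)=\#\{j:\sigma^{-1}_\ell<j<n,\ \sigma_{j+1}<\ell<\sigma_j\}$,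 - $\underline{31}2(\ell,\sigma)=\#\{j:1<j<\sigma^{-1}_\ell,\ \sigma_j<\ell<\sigma_{j-1}\}$, and let $2\underline{13}(\sigma)$, $2\underline{31}(\sigma)$, $\underline{31}2(\sigma)$ be the sums of the corresponding quantities over $1\le\ell\le n$. The bijection $\Phi_{\mathrm{SZ}}:\mathfrak{S}_n\to\mathfrak{S}_n$: given $\sigma$, let $F$ be the set of descent tops (letters $\sigma_i$ with $1\le i<n$, $\sigma_i>\sigma_{i+1}$) and $F'$ the set of descent bottoms (letters $\sigma_{i+1}$ with $1\le i<n$, $\sigma_i>\sigma_{i+1}$); let $G=[n]\setminus F$, $G'=[n]\setminus F'$. Define $\tau=\Phi_{\mathrm{SZ}}(\sigma)$ as follows. Going through $j\in F$ from the smallest to the largest, let $\tau_j$ be the $(\underline{31}2(j,\sigma)+1)$-th largest entry of $F'$ that is smaller than $j$ and not yet chosen. Going through $j\in G$ from the largest to the smallest, let $\tau_j$ be the $(\underline{31}2(j,\sigma)+1)$-th smallest entry of $G'$ that is not smaller than $j$ and not yet chosen. (This is known to be a well-defined bijection.) The map $\widehat{\theta}:\mathfrak{S}_n\to\mathfrak{S}_n$ is $\widehat{\theta}(\sigma)=\widehat{\sigma}_n\widehat{\sigma}_{n-1}\cdots\widehat{\sigma}_1$, where $\widehat{a}=n-a$ if $1\le a<n$ and $\widehat{n}=n$. *)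

(* Defs.v *)
From mathcomp Require Import all_boot all_fingroup zify.

Set Implicit Arguments.
Unset Strict Implicit.
Unset Printing Implicit Defensive.

(* A permutation of [n] = {1, ..., n} is an element [s] of ['S_n]; letters and
   positions are shifted down by one, so the one-line word of [s] is
   [s 0, s 1, ..., s (n - 1)]. On ['I_n], [ordS j] and [ord_pred j] are cyclic,
   so they are only used below under a guard that makes them [j + 1], [j - 1]. *)

(* Vincular patterns: [p] is the pattern word and [bonds] lists the (0-based)
   indices [i] such that the letters [i] and [i.+1] of [p] lie under a common
   underline. An occurrence is given by its positions [t 0 < t 1 < ...]. *)
Definition occurrence n k (p : k.-tuple nat) (bonds : seq nat) (s : 'S_n)
    (t : {ffun 'I_k -> 'I_n}) : bool :=
  [&& [forall i : 'I_k, forall j : 'I_k, (i < j) ==> (t i < t j)],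
      [forall i : 'I_k, forall j : 'I_k,
         (s (t i) < s (t j)) == (tnth p i < tnth p j)]
    & [forall i : 'I_k, forall j : 'I_k,
         (nat_of_ord i \in bonds) && (j == i.+1 :> nat) ==> (t j == (t i).+1 :> nat)]].

Definition avoids n k (p : k.-tuple nat) (bonds : seq nat) (s : 'S_n) : bool :=
  ~~ [exists t : {ffun 'I_k -> 'I_n}, occurrence p bonds s t].

Definition baxter n (s : 'S_n) : bool :=
  avoids [tuple 3; 1; 4; 2] [:: 1] s && avoids [tuple 2; 4; 1; 3] [:: 1] s.

Section Statistics.
Variables (n : nat) (s : 'S_n).

Definition pos (l : 'I_n) : 'I_n := (s^-1)%g l.

Definition stat213_at (l : 'I_n) : nat :=
  #|[set j : 'I_n | [&& pos l < j, j.+1 < n & s j < l < s (ordS j)]]|.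

Definition stat231_at (l : 'I_n) : nat :=
  #|[set j : 'I_n | [&& pos l < j, j.+1 < n & s (ordS j) < l < s j]]|.

Definition stat312_at (l : 'I_n) : nat :=
  #|[set j : 'I_n | [&& 0 < j, j < pos l & s j < l < s (ord_pred j)]]|.

Definition stat213 : nat := \sum_(l < n) stat213_at l.
Definition stat231 : nat := \sum_(l < n) stat231_at l.
Definition stat312 : nat := \sum_(l < n) stat312_at l.

Definition descent (i : 'I_n) : bool := (i.+1 < n) && (s (ordS i) < s i).
Definition descent_tops : {set 'I_n} := [set s i | i : 'I_n & descent i].
Definition descent_bottoms : {set 'I_n} :=
  [set s (ordS i) | i : 'I_n & descent i].

End Statistics.

(* [greedy pick js] goes through [js] from left to right and lists the values
   chosen; [pick j ys] is the choice for [j] when [ys] are already chosen. *)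
Definition greedy (T : Type) (pick : T -> seq T -> T) (js : seq T) : seq T :=
  foldl (fun ys j => rcons ys (pick j ys)) [::] js.

Section PhiSZ.
Variables (n : nat) (s : 'S_n).

Local Notation F := (descent_tops s).
Local Notation F' := (descent_bottoms s).

(* [enum A] is increasing for [A : {set 'I_n}]. There are always more than
   [stat312_at s j] candidates, so the default value [j] of [nth] is not used. *)
Definition pickF (j : 'I_n) (chosen : seq 'I_n) : 'I_n :=
  nth j (rev [seq x : 'I_n <- enum F' | (x < j) && (x \notin chosen)])
        (stat312_at s j).

Definition pickG (j : 'I_n) (chosen : seq 'I_n) : 'I_n :=
  nth j [seq x : 'I_n <- enum (~: F') | (j <= x) && (x \notin chosen)]
        (stat312_at s j).

Definition PhiSZ_fun (j : 'I_n) : 'I_n :=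
  let js := if j \in F then enum F else rev (enum (~: F)) in
  let pick := if j \in F then pickF else pickG in
  nth j (greedy pick js) (index j js).

(* [PhiSZ_fun] is always injective, so the default value [1] is not used. *)
Definition PhiSZ : 'S_n := insubd (1%g : 'S_n) [ffun j => PhiSZ_fun j].

End PhiSZ.

(* On 1-based letters this is [a |-> n - a] for [a < n] and [n |-> n]. *)
Definition hat n (a : 'I_n) : 'I_n :=
  if a.+1 == n then a else insubd a (n - a.+2).

Lemma hat_val n (a : 'I_n) :
  hat a = (if a.+1 == n then a : nat else n - a.+2) :> nat.
Proof.
rewrite /hat; case: eqVneq => // ne.
have lt_an : a.+1 < n by rewrite ltn_neqAle ne ltn_ord.
by rewrite val_insubd ltn_subrL /= (leq_trans _ lt_an).
Qed.

Lemma hatK n : involutive (@hat n).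
Proof.
move=> a; apply/val_inj; rewrite /= !hat_val.
have lt_an := ltn_ord a; case: (eqVneq a.+1 n) => [->|ne]; first by rewrite eqxx.
by case: eqP; lia.
Qed.

Lemma thetahat_inj n (s : 'S_n) : injective (fun i => hat (s (rev_ord i))).
Proof.
by move=> i j /(can_inj (@hatK n)) /perm_inj /rev_ord_inj.
Qed.

Definition thetahat n (s : 'S_n) : 'S_n := perm (@thetahat_inj n s).

(* [PhiSZ] is a bijection of the finite type ['S_n]; [finv] is its inverse. *)
Definition phihat n (s : 'S_n) : 'S_n :=
  finv (@PhiSZ n) (thetahat (PhiSZ s)).

(* Main.v *)
Require Import Defs.
From mathcomp Require Import all_boot all_order all_fingroup all_algebra.
From mathcomp Require Import zify.

Set Implicit Arguments.
Unset Strict Implicit.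
Unset Printing Implicit Defensive.

(** Write [a l] for [stat312_at s l], [F] and [F'] for the sets of descent tops
    and descent bottoms of [s], and [t] for [PhiSZ s]. The proof rests on two
    descriptions of the same data.

    On the side of [s]: an occurrence of a Baxter pattern can always be moved to
    one whose letters 2 and 3 are consecutive integers [l], [l + 1], because
    the letters between them switch side of the underlined pair somewhere. For
    consecutive letters, counting the descents that jump over them gives
    - [a (l + 1) = a l + [l \in F'] + D] when [l] stands left of [l + 1], where
      [D] counts the forbidden descents between them;
    - [a l + [l \in F'] = a (l + 1) + 1 + U] when [l] stands right of [l + 1],
      where [U] counts the forbidden ascents between them.
    Hence [s] is Baxter if and only if
    [a (l + 1) <= a l + [l \in F'] <= a (l + 1) + 1] for every [l] ([baxterP]).

    On the side of [t]: drawing an arc from [j] to [t j] for every [j], the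
    letters of [F] are the sources of the lower arcs ([t j < j]), those of [F']
    their targets, and [a j] is the number of crossings on the arc of [j], each
    crossing being attributed to one of its two arcs ([PhiSZ_crossing]). These
    data determine [s] ([stat312_determines]), so that [PhiSZ] is injective.

    The map [thetahat] reflects the arc diagram and moves every target by one
    step, except the maximal one. This exchanges lower and upper arcs, so it
    reverses the sequence [a] and complements [F'] on the reflected letters.
    The condition above on the pair [l], [l + 1] is turned into the same
    condition on the reflected pair, whence the closure of Baxter permutations.

    For the equidistribution, [a l + stat231_at s l] is the number of descents
    that jump over [l], which is the number of lower arcs over [l], while
    [stat213_at s l - stat231_at s l] depends only on whether [l] is a descent
    top and on the comparison of [l] with the last letter of [s]. That last
    letter is the preimage of the maximum under [t] ([last_letter_preim]), the
    one arc which [thetahat] does not exchange, and the correction terms match: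
    [stat231_at (phihat s) (rev_ord l) = stat213_at s l]. As [phihat] is an
    involution, it exchanges the two statistics. *)

(** * Descents and ascents over a letter *)

Section Crossings.
Variables (n : nat) (s : 'S_n.+1).
Implicit Types (l : 'I_n.+1) (i j k : nat).

(** The word of [s] is read at natural number positions, so that a sum over a
    stretch of positions is an ordinary interval sum. *)
Definition letter k : nat := s (inord k).

Lemma letter_ord l : letter l = s l.
Proof. by rewrite /letter inord_val. Qed.

Lemma letter_pos l : letter (pos s l) = l.
Proof. by rewrite letter_ord /pos permKV. Qed.

Lemma pos_le l : pos s l <= n.
Proof. by rewrite -ltnS ltn_ord. Qed.

Lemma letter_eq k l : k <= n -> (letter k == l) = (k == pos s l).
Proof.
move=> le_kn; rewrite /letter; apply/eqP/eqP => [/val_inj <-|E].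
  by rewrite /pos permK inordK.
by rewrite (_ : inord k = pos s l) ?permKV //; apply/val_inj; rewrite /= inordK.
Qed.

Lemma letter_inj i j : i <= n -> j <= n -> letter i = letter j -> i = j.
Proof.
move=> le_in le_jn /val_inj /perm_inj E.
by rewrite -(@inordK n i) // E inordK.
Qed.

Definition downs l i j : nat :=
  \sum_(i <= k < j) ((letter k.+1 < l < letter k) : nat).
Definition ups l i j : nat :=
  \sum_(i <= k < j) ((letter k < l < letter k.+1) : nat).

Lemma card_below (A : pred 'I_n.+1) (Q : nat -> bool) :
  (forall j : 'I_n.+1, A j = (j < n) && Q j) ->
  #|[set j | A j]| = \sum_(0 <= k < n) (Q k : nat).
Proof.
move=> AQ; rewrite -sum1dep_card big_mkcond /= big_ord_recr /= AQ ltnn addn0.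
rewrite big_mkord; apply: eq_bigr => i _.
by rewrite AQ /= ltn_ord /=; case: (Q i).
Qed.

Lemma letterS (j : 'I_n.+1) : j < n -> s (ordS j) = letter j.+1 :> nat.
Proof.
move=> lt_jn; rewrite /letter; congr (nat_of_ord (s _)).
by apply/val_inj; rewrite /= inordK ?modn_small.
Qed.

Lemma sum_restrict i j (Q : nat -> bool) m : i <= j <= m ->
  \sum_(0 <= k < m) ((i <= k < j) && Q k : nat) = \sum_(i <= k < j) (Q k : nat).
Proof.
case/andP=> le_ij le_jm.
rewrite (@big_cat_nat _ _ _ j) //= (@big_cat_nat _ _ _ i) //=.
have -> : \sum_(0 <= k < i) ((i <= k < j) && Q k : nat) = 0.
  by rewrite big_nat big1 // => k; case: (Q k); rewrite ?andbF //; lia.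
have -> : \sum_(j <= k < m) ((i <= k < j) && Q k : nat) = 0.
  by rewrite big_nat big1 // => k; case: (Q k); rewrite ?andbF //; lia.
rewrite add0n addn0.
by rewrite big_nat [RHS]big_nat; apply: eq_bigr => k ->.
Qed.

Lemma stat231_downs l : stat231_at s l = downs l (pos s l) n.
Proof.
rewrite /downs -(@sum_restrict _ _ _ n) ?pos_le ?leqnn //; apply: card_below => j.
rewrite ltnS; case: (ltnP j n) => [lt_jn|]; last by rewrite /= andbF.
rewrite letterS // -letter_ord /=.
have := @letter_eq j l (ltnW lt_jn); lia.
Qed.

Lemma stat213_ups l : stat213_at s l = ups l (pos s l) n.
Proof.
rewrite /ups -(@sum_restrict _ _ _ n) ?pos_le ?leqnn //; apply: card_below => j.
rewrite ltnS; case: (ltnP j n) => [lt_jn|]; last by rewrite /= andbF.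
rewrite letterS // -letter_ord /=.
have := @letter_eq j l (ltnW lt_jn); lia.
Qed.

Lemma stat312_downs l : stat312_at s l = downs l 0 (pos s l).
Proof.
rewrite /downs -(@sum_restrict _ _ _ n) ?pos_le //=.
rewrite /stat312_at -sum1dep_card big_mkcond /= big_ord_recl /= add0n.
rewrite big_mkord; apply: eq_bigr => i _ /=.
have -> : s (ord_pred (lift ord0 i)) = letter i :> nat.
  rewrite /letter; congr (nat_of_ord (s _)); apply/val_inj => /=.
  by rewrite /bump /= modnDr inordK ?modn_small ?add0n ?ltnS ?(ltnW (ltn_ord i)).
rewrite -letter_ord /= /bump /= add1n.
have := @letter_eq i.+1 l (ltn_ord i).
by case: ifP; lia.
Qed.

Lemma stat312D231 l : stat312_at s l + stat231_at s l = downs l 0 n.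
Proof.
by rewrite stat312_downs stat231_downs /downs -big_cat_nat ?pos_le.
Qed.

(** A walk enters the set of positions satisfying [b] and leaves it alternately,
    so the two counts differ only by the status of the endpoints. *)
Lemma crossing_balance (b : nat -> bool) i j : i <= j ->
  \sum_(i <= k < j) (~~ b k && b k.+1 : nat) + b i
  = \sum_(i <= k < j) (b k && ~~ b k.+1 : nat) + b j.
Proof.
elim: j => [|j IH]; first by rewrite leqn0 => /eqP->; rewrite !big_geq.
rewrite leq_eqVlt => /predU1P[<-|le_ij]; first by rewrite !big_geq.
rewrite !big_nat_recr //=; have {}IH := IH le_ij.
by case: (b j) (b j.+1) IH => [] []; lia.
Qed.

Lemma mem_tops l :
  (l \in descent_tops s) = (pos s l < n) && (letter (pos s l).+1 < l).
Proof.
apply/imsetP/andP => [[i]|[lt_pn lt_l]].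
  rewrite inE /descent ltnS => /andP[lt_in]; rewrite letterS // => lt_s ->.
  by rewrite /pos permK; split.
have sp : s (pos s l) = l by rewrite /pos permKV.
by exists (pos s l); rewrite ?inE /descent ?ltnS ?lt_pn ?letterS ?sp.
Qed.

Lemma mem_bottoms l :
  (l \in descent_bottoms s) = (0 < pos s l) && (l < letter (pos s l).-1).
Proof.
apply/imsetP/andP => [[i]|[lt_0p lt_l]].
  rewrite inE /descent ltnS => /andP[lt_in lt_s ->].
  rewrite /pos permK /= modn_small ?ltnS //=; split=> //.
  by rewrite letter_ord.
have lt_pn : (pos s l).-1 < n by have := pos_le l; lia.
have iE : (inord (pos s l).-1 : 'I_n.+1) = (pos s l).-1 :> nat.
  by rewrite inordK // ltnS ltnW.
have pE : ordS (inord (pos s l).-1) = pos s l :> 'I_n.+1.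
  by apply/val_inj; rewrite /= iE prednK // modn_small // ltnS pos_le.
have sp : s (pos s l) = l by rewrite /pos permKV.
exists (inord (pos s l).-1); last by rewrite pE sp.
by rewrite inE /descent pE sp -letter_ord iE lt_l ltnS lt_pn.
Qed.

Definition last_letter : 'I_n.+1 := s ord_max.

Lemma pos_last : pos s last_letter = ord_max.
Proof. by rewrite /pos permK. Qed.

Lemma letter_last : letter n = last_letter.
Proof. by have := letter_pos last_letter; rewrite pos_last. Qed.

Lemma sum_indicator (Q : nat -> bool) p i j : i <= p < j ->
  (forall k, i <= k < j -> Q k -> k = p) ->
  \sum_(i <= k < j) (Q k : nat) = Q p.
Proof.
move=> /andP[ip pj] Qp; rewrite (@big_cat_nat _ _ _ p) ?(ltnW pj) //=.
rewrite big_nat big1 ?add0n => [|k k_lt].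
  rewrite big_ltn // big_nat big1 ?addn0 // => k k_lt.
  by case E: (Q k) => //; have := Qp k _ E; lia.
by case E: (Q k) => //; have := Qp k _ E; lia.
Qed.

(** Right of [l] the word alternately goes up and down through the level [l], so
    [stat213_at] and [stat231_at] differ only by what happens at the two ends:
    the step leaving [l] and the position of the last letter. *)
Lemma stat213_231 l : stat213_at s l + (l \notin descent_tops s)
  = stat231_at s l + (l <= last_letter).
Proof.
rewrite stat213_ups stat231_downs.
have := @crossing_balance (fun k => l < letter k) (pos s l) n (pos_le l).
rewrite letter_pos ltnn addn0 letter_last.
have -> : \sum_(pos s l <= k < n) ((l < letter k) && ~~ (l < letter k.+1) : nat) =
    downs l (pos s l) n.
  rewrite /downs big_nat [RHS]big_nat; apply: eq_bigr => k /andP[le_pk lt_kn].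
  have := @letter_eq k.+1 l lt_kn; lia.
have := @letter_eq (pos s l) l (pos_le l); rewrite eqxx => /eqP lp.
case: (ltnP (pos s l) n) => [lt_pn|le_np].
  have -> : \sum_(pos s l <= k < n) (~~ (l < letter k) && (l < letter k.+1) : nat) =
    ups l (pos s l) n + (l \notin descent_tops s).
    have := @sum_indicator (fun k => (letter k == l) && (l < letter k.+1)) (pos s l) (pos s l) n.
    rewrite leqnn lt_pn lp eqxx /= => /(_ isT) SO.
    rewrite mem_tops lt_pn /=.
    have -> : ~~ (letter (pos s l).+1 < l) = (l < letter (pos s l).+1).
      have := @letter_eq (pos s l).+1 l lt_pn; lia.
    rewrite -SO => [|k /andP[_ lt_kn]]; last first.
      by rewrite (@letter_eq k l (ltnW lt_kn)) => /andP[/eqP].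
    rewrite -big_split big_nat [RHS]big_nat; apply: eq_bigr => k /andP[le_pk lt_kn] /=.
    lia.
  have : last_letter != l.
    apply: contraTneq lt_pn => <-; by rewrite pos_last ltnn.
  rewrite -val_eqE /=; lia.
have pE : pos s l = ord_max by apply/val_inj => /=; have := pos_le l; lia.
have lE : last_letter = l by rewrite /last_letter -pE /pos permKV.
rewrite mem_tops lE /ups /downs !big_geq // leqnn; lia.
Qed.

(** Every descent whose bottom is below [l] either jumps over [l] or has its top
    at most [l]. This expresses the number of descents over [l] by the two sets
    alone, which is what [PhiSZ] preserves. *)
Lemma spanning_tops_bottoms l :
  downs l 0 n + #|[set x in descent_tops s | x <= l]|
  = #|[set x in descent_bottoms s | x < l]|.
Proof.
have -> : [set x in descent_tops s | x <= l] =
    [set s i | i in [set i : 'I_n.+1 | (i < n) && (letter i.+1 < letter i <= l)]].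
  apply/setP => x; rewrite !inE; apply/andP/imsetP => [[/imsetP[i]]|[i]].
    rewrite inE /descent ltnS => /andP[lt_in lt_s -> le_l]; exists i => //.
    by rewrite inE lt_in -letterS // letter_ord lt_s.
  rewrite inE => /and3P[lt_in lt_s le_l ->]; rewrite -letter_ord le_l; split => //.
  apply/imsetP; exists i => //.
  by rewrite inE /descent ltnS lt_in letterS // -letter_ord.
rewrite card_imset; last exact: perm_inj.
have -> : [set x in descent_bottoms s | x < l] =
    [set s (ordS i) | i in [set i : 'I_n.+1 |
       (i < n) && ((letter i.+1 < letter i) && (letter i.+1 < l))]].
  apply/setP => x; rewrite !inE; apply/andP/imsetP => [[/imsetP[i]]|[i]].
    rewrite inE /descent ltnS => /andP[lt_in lt_s -> le_l]; exists i => //.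
    by rewrite inE lt_in -letterS // letter_ord lt_s.
  rewrite inE => /and3P[lt_in lt_s le_l ->]; rewrite letterS // le_l; split => //.
  apply/imsetP; exists i => //.
  by rewrite inE /descent ltnS lt_in letterS // -letter_ord.
rewrite card_imset; last by move=> x y /perm_inj /(can_inj (@ordSK _)).
rewrite (@card_below _ (fun k => letter k.+1 < letter k <= l) (fun x => erefl _)).
rewrite (@card_below _ (fun k => (letter k.+1 < letter k) && (letter k.+1 < l))
  (fun x => erefl _)) /downs -big_split /=.
by apply: eq_bigr => k _; lia.
Qed.

Lemma card_tops_bottoms : #|descent_tops s| = #|descent_bottoms s|.
Proof.
rewrite !card_imset //; last exact: perm_inj.
by move=> x y /perm_inj /(can_inj (@ordSK _)).
Qed.

End Crossings.

(** * Baxter permutations *)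

Section Baxter.
Variables (n : nat) (s : 'S_n.+1).
Implicit Types (l : 'I_n.+1) (i j k : nat).
Local Notation letter := (letter s).

Definition occurs4 (p : 4.-tuple nat) : Prop := exists i j k,
  [/\ i < j, j.+1 < k, k <= n &
   forall x y : 'I_4, (nth 0 [:: letter i; letter j; letter j.+1; letter k] x
     < nth 0 [:: letter i; letter j; letter j.+1; letter k] y)
   = (tnth p x < tnth p y)].

Lemma avoids4P (p : 4.-tuple nat) :
  reflect (~ occurs4 p) (avoids p [:: 1] s).
Proof.
apply: (iffP negP) => [noocc [i [j [k [ij jk kn iso]]]]|noocc /existsP[t]].
  apply: noocc; apply/existsP.
  exists [ffun x : 'I_4 => inord (nth 0 [:: i; j; j.+1; k] x)].
  have E (x : 'I_4) : s (inord (nth 0 [:: i; j; j.+1; k] x)) =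
      nth 0 [:: letter i; letter j; letter j.+1; letter k] x :> nat.
    by case: x => [[|[|[|[|x]]]]].
  apply/and3P; split; apply/forallP => x; apply/forallP => y; rewrite !ffunE.
  - apply/implyP => lt_xy; rewrite !inordK.
    + by move: x y lt_xy => [[|[|[|[|x]]]] ?] [[|[|[|[|y]]]] ?] //= _; lia.
    + by move: y {lt_xy} => [[|[|[|[|y]]]] ?] //=; lia.
    + by move: x {lt_xy} => [[|[|[|[|x]]]] ?] //=; lia.
  - by rewrite !E iso.
  - apply/implyP; rewrite inE => /andP[/eqP x1 /eqP y2].
    by rewrite y2 x1 /= !inordK //; lia.
case/and3P => /forallP inc /forallP iso /forallP adj; apply: noocc.
have inc' (x y : 'I_4) : x < y -> t x < t y by move/forallP/(_ y)/implyP: (inc x).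
have e2 : t (inord 2) = (t (inord 1)).+1 :> nat.
  move/forallP/(_ (inord 2))/implyP: (adj (inord 1)).
  by rewrite !inordK // => /(_ isT)/eqP.
exists (t (inord 0)), (t (inord 1)), (t (inord 3)); split.
- by apply: inc'; rewrite !inordK.
- by rewrite -e2; apply: inc'; rewrite !inordK.
- by rewrite -ltnS ltn_ord.
have E (x : 'I_4) : nth 0 [:: letter (t (inord 0)); letter (t (inord 1));
   letter (t (inord 1)).+1; letter (t (inord 3))] x = s (t x).
  rewrite -e2 !letter_ord -[in RHS](inord_val x).
  by case: x => [[|[|[|[|x]]]]].
by move=> x y; rewrite !E; move/forallP/(_ y)/eqP: (iso x).
Qed.

(** The occurrences of the two Baxter patterns whose letters 2 and 3 are the
    consecutive integers [l] and [l'], recorded by the position of the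
    underlined pair. *)
Definition bad_descent l (l' : 'I_n.+1) k := [&& pos s l <= k, k < pos s l',
  letter k.+1 < l & l' < letter k].
Definition bad_ascent l (l' : 'I_n.+1) k := [&& pos s l' <= k, k < pos s l,
  letter k < l & l' < letter k.+1].

Lemma exists_switch (Q : pred nat) i j : i < j -> Q i -> ~~ Q j ->
  exists k, [/\ i <= k, k < j, Q k & ~~ Q k.+1].
Proof.
move=> lt_ij Qi Qj.
have exk : exists k, (i <= k) && ~~ Q k.+1.
  by exists j.-1; rewrite prednK ?Qj; lia.
case: (ex_minnP exk) => k /andP[le_ik Qk'] min_k; exists k; split=> //.
  have /min_k : (i <= j.-1) && ~~ Q j.-1.+1 by rewrite prednK ?Qj; lia.
  by lia.
case: (leqP k i) => [le_ki|lt_ik]; first by rewrite (_ : k = i) //; lia.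
apply/negPn/negP => nQk; have /(_ k.-1) := min_k.
rewrite prednK; last by lia.
by rewrite nQk andbT; lia.
Qed.

Lemma pos_letter k : k <= n -> pos s (inord (letter k)) = k :> nat.
Proof.
move=> le_kn; apply/esym/eqP; rewrite -(@letter_eq _ s k) // inordK //.
by rewrite /letter ltn_ord.
Qed.

Lemma letter_ltn k : letter k < n.+1.
Proof. by rewrite /letter ltn_ord. Qed.

(** The letters from the 2 to the 3 of an occurrence start left of the
    underlined pair and end right of it, so two consecutive ones are on
    different sides. *)
Lemma occurs2413P : occurs4 [tuple 2; 4; 1; 3] <->
  exists l l' k, l' = l.+1 :> nat /\ bad_descent l l' k.
Proof.
split=> [[i [j [k [lt_ij lt_jk le_kn iso]]]]|[l [l' [j [l'E /and4P[]]]]]].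
  have := iso (inord 2) (inord 0); have := iso (inord 0) (inord 3).
  have := iso (inord 3) (inord 1); rewrite !(tnth_nth 0) !inordK //= => b1 b2 b3.
  have [m [m1 m2 Qm Qm']] := @exists_switch (fun x => pos s (inord x) <= j) (letter i)
    (letter k) b2 ltac:(rewrite /= pos_letter; lia) ltac:(rewrite /= pos_letter; lia).
  have := letter_ltn k => lk.
  exists (inord m), (inord m.+1), j; split; rewrite /bad_descent ?inordK; lia.
move=> pj jp' lt_l l'_lt; exists (pos s l), j, (pos s l').
have := pos_le s l'; have := @letter_eq _ s j l; have := @letter_eq _ s j.+1 l'.
move=> e1 e2 ple; split; try lia.
move=> [[|[|[|[|x]]]] ?] [[|[|[|[|y]]]] ?]; rewrite ?(tnth_nth 0) //= ?letter_pos; lia.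
Qed.

Lemma occurs3142P : occurs4 [tuple 3; 1; 4; 2] <->
  exists l l' k, l' = l.+1 :> nat /\ bad_ascent l l' k.
Proof.
split=> [[i [j [k [lt_ij lt_jk le_kn iso]]]]|[l [l' [j [l'E /and4P[]]]]]].
  have := iso (inord 1) (inord 3); have := iso (inord 3) (inord 0).
  have := iso (inord 0) (inord 2); rewrite !(tnth_nth 0) !inordK //= => b1 b2 b3.
  have [m [m1 m2 Qm Qm']] := @exists_switch (fun x => j < pos s (inord x)) (letter k)
    (letter i) b2 ltac:(rewrite /= pos_letter; lia) ltac:(rewrite /= pos_letter; lia).
  have := letter_ltn i => lk.
  exists (inord m), (inord m.+1), j; split; rewrite /bad_ascent ?inordK; lia.
move=> pj jp' lt_l l'_lt; exists (pos s l'), j, (pos s l).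
have := pos_le s l; have := @letter_eq _ s j l'; have := @letter_eq _ s j.+1 l.
move=> e1 e2 ple; split; try lia.
move=> [[|[|[|[|x]]]] ?] [[|[|[|[|y]]]] ?]; rewrite ?(tnth_nth 0) //= ?letter_pos; lia.
Qed.

Lemma sum_last (Q : nat -> bool) i j :
  \sum_(i <= k < j) ((k.+1 == j) && Q k : nat) = (i < j) && Q j.-1.
Proof.
case: (ltnP i j) => [lt_ij|]; last by move=> le_ji; rewrite big_geq.
rewrite (@sum_indicator (fun k => (k.+1 == j) && Q k) j.-1) ?prednK ?eqxx //; lia.
Qed.

(** The descents over [l'] and left of it are those over [l] and left of it, the
    one that ends at [l], and those between [l] and [l']; the last ones are the
    occurrences of the pattern. *)
Lemma stat312_step_left l (l' : 'I_n.+1) : l' = l.+1 :> nat -> pos s l < pos s l' ->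
  stat312_at s l' = stat312_at s l + (l \in descent_bottoms s)
    + \sum_(pos s l <= k < pos s l') ((letter k.+1 < l) && (l' < letter k) : nat).
Proof.
move=> l'E lt_pp'; rewrite !stat312_downs mem_bottoms.
rewrite -(@sum_last (fun k => l < letter k)) /downs.
rewrite (@big_cat_nat _ _ _ (pos s l)) ?(ltnW lt_pp') //= -big_split /=.
have p'n := pos_le s l'.
congr (_ + _); rewrite big_nat [RHS]big_nat; apply: eq_bigr => k lt_k /=.
  have := @letter_eq _ s k l' ltac:(lia); have := @letter_eq _ s k.+1 l ltac:(lia); lia.
have := @letter_eq _ s k.+1 l ltac:(lia); lia.
Qed.

(** The descents counted for [l] but not for [l'] lie between the two letters.
    On this stretch the word starts above the level [l] and ends at [l], so it
    crosses the level downwards once more than upwards, and its upward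
    crossings are the occurrences of the pattern. *)
Lemma stat312_step_right l (l' : 'I_n.+1) : l' = l.+1 :> nat -> pos s l' < pos s l ->
  stat312_at s l + (l \in descent_bottoms s) = stat312_at s l' + 1
    + \sum_(pos s l' <= k < pos s l) ((letter k < l) && (l' < letter k.+1) : nat).
Proof.
move=> l'E lt_p'p; rewrite !stat312_downs mem_bottoms.
have pn := pos_le s l.
have := @crossing_balance (fun k => l < letter k) _ _ (ltnW lt_p'p).
rewrite !letter_pos l'E ltnSn ltnn addn0.
have -> : \sum_(pos s l' <= k < pos s l) (~~ (l < letter k) && (l < letter k.+1) : nat)
  = \sum_(pos s l' <= k < pos s l) ((letter k < l) && (l.+1 < letter k.+1) : nat).
  rewrite big_nat [RHS]big_nat; apply: eq_bigr => k lt_k /=.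
  have := @letter_eq _ s k l ltac:(lia); have := @letter_eq _ s k.+1 l' ltac:(lia); lia.
have -> : \sum_(pos s l' <= k < pos s l) ((l < letter k) && ~~ (l < letter k.+1) : nat)
  = downs s l (pos s l') (pos s l) + ((0 < pos s l) && (l < letter (pos s l).-1)).
  rewrite (_ : (0 < pos s l) = (pos s l' < pos s l)); last by lia.
  rewrite -(@sum_last (fun k => l < letter k)) /downs -big_split /=.
  rewrite big_nat [RHS]big_nat; apply: eq_bigr => k lt_k /=.
  have := @letter_eq _ s k.+1 l ltac:(lia); lia.
have -> : downs s l 0 (pos s l) =
    downs s l' 0 (pos s l') + downs s l (pos s l') (pos s l).
  rewrite /downs (@big_cat_nat _ _ _ (pos s l')) ?(ltnW lt_p'p) //=.
  congr (_ + _); rewrite big_nat [RHS]big_nat; apply: eq_bigr => k lt_k /=.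
  have := @letter_eq _ s k l' ltac:(lia); have := @letter_eq _ s k.+1 l ltac:(lia); lia.
lia.
Qed.

(** The Baxter property is a condition on the numbers [stat312_at] and the
    descent bottoms, the data that [PhiSZ] transports. *)
Theorem baxterP : reflect
  (forall l (l' : 'I_n.+1), l' = l.+1 :> nat ->
    stat312_at s l' <= stat312_at s l + (l \in descent_bottoms s)
      <= (stat312_at s l').+1)
  (baxter s).
Proof.
have sum0 (Q : nat -> bool) i j :
    (\sum_(i <= k < j) (Q k : nat) == 0) = ~~ has Q (index_iota i j).
  by rewrite sum_nat_seq_eq0 -all_predC; apply: eq_all => k /=; case: (Q k).
have left_or_right l (l' : 'I_n.+1) : l' = l.+1 :> nat -> pos s l < pos s l' \/ pos s l' < pos s l.
  move=> l'E; case: (ltngtP (pos s l) (pos s l')) => [||E]; [by left|by right|].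
  by have := letter_pos s l; rewrite E letter_pos; lia.
apply: (iffP andP) => [[/avoids4P av1 /avoids4P av2] l l' l'E|steps].
  case: (left_or_right _ _ l'E) => ltp.
    have := stat312_step_left l'E ltp.
    have /eqP-> : \sum_(pos s l <= k < pos s l')
        ((letter k.+1 < l) && (l' < letter k) : nat) == 0.
      rewrite sum0; apply/hasP => -[k]; rewrite mem_index_iota => kI bad.
      by apply/av2/occurs2413P; exists l, l', k; split=> //; rewrite /bad_descent; lia.
    by lia.
  have := stat312_step_right l'E ltp.
  have /eqP-> : \sum_(pos s l' <= k < pos s l)
      ((letter k < l) && (l' < letter k.+1) : nat) == 0.
    rewrite sum0; apply/hasP => -[k]; rewrite mem_index_iota => kI bad.
    by apply/av1/occurs3142P; exists l, l', k; split=> //; rewrite /bad_ascent; lia.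
  by lia.
split; apply/avoids4P.
  move=> /occurs3142P[l [l' [k [l'E /and4P[pk kp b1 b2]]]]].
  have := stat312_step_right l'E (leq_ltn_trans pk kp); have := steps _ _ l'E.
  have : \sum_(pos s l' <= k < pos s l) ((letter k < l) && (l' < letter k.+1) : nat) != 0.
    rewrite sum0 negbK; apply/hasP; exists k; rewrite ?mem_index_iota; lia.
  by lia.
move=> /occurs2413P[l [l' [k [l'E /and4P[pk kp b1 b2]]]]].
have := stat312_step_left l'E (leq_ltn_trans pk kp); have := steps _ _ l'E.
have : \sum_(pos s l <= k < pos s l') ((letter k.+1 < l) && (l' < letter k) : nat) != 0.
  rewrite sum0 negbK; apply/hasP; exists k; rewrite ?mem_index_iota; lia.
by lia.
Qed.

End Baxter.

(** * Reconstruction of a permutation *)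

Section Injectivity.
Variables (n : nat).
Implicit Types (s r : 'S_n.+1) (l : 'I_n.+1).

Lemma downs_eq_prefix s r l k : (forall i, i <= k -> letter s i = letter r i) ->
  downs s l 0 k = downs r l 0 k.
Proof.
move=> E; rewrite /downs !big_mkord; apply: eq_bigr => i _.
by have lt_ik := ltn_ord i; rewrite !E // ltnW.
Qed.

Lemma downs_split s l i j k : i <= j <= k -> downs s l i k = downs s l i j + downs s l j k.
Proof. by case/andP=> *; rewrite /downs -big_cat_nat. Qed.

Lemma downsS s l k : downs s l 0 k.+1 = downs s l 0 k + (letter s k.+1 < l < letter s k).
Proof. by rewrite /downs big_nat_recr. Qed.

(** Suppose that the words agree before position [k] and that [s] has the smaller
    letter there. If the previous letter is a descent top, the descent of [s]
    into position [k] jumps over the letter [l] of [r], which [s] must place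
    later and so counts more descents for [l] than [r]. Otherwise the letter
    [l] of [s] is not a descent bottom, so [r], which is above [l] at position
    [k], comes back below [l] by jumping over it before reaching it, and counts
    more descents for [l] than [s]. *)
Lemma no_first_difference s r k :
  descent_tops s = descent_tops r -> descent_bottoms s = descent_bottoms r ->
  stat312_at s =1 stat312_at r -> k <= n ->
  (forall i, i < k -> letter s i = letter r i) -> letter r k <= letter s k.
Proof.
move=> eqF eqF' eqa le_kn eq_lt; rewrite leqNgt; apply/negP => lt_sr.
(* The letter that [q'] reads at position [k] is not yet used in [q]. *)
have later (q q' : 'S_n.+1) : (forall i, i < k -> letter q i = letter q' i) ->
    letter q k <> letter q' k -> k < pos q (inord (letter q' k)).
  move=> eq_q ne_q; set p := nat_of_ord (pos _ _).
  have le_pn : p <= n by apply: pos_le.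
  have pE : letter q p = letter q' k.
    by rewrite letter_pos inordK // letter_ltn.
  case: (ltngtP k p) => // [lt_pk|eq_pk]; last by case: ne_q; rewrite -pE -eq_pk.
  by move: pE; rewrite eq_q // => /letter_inj; lia.
(* The descent of [s] into position [k] is the extra one. *)
case: (boolP ((0 < k) && (inord (letter s k.-1) \in descent_tops s))).
  case/andP=> k_gt0 topc; set l : 'I_n.+1 := inord (letter r k).
  have lE : l = letter r k :> nat by rewrite inordK // letter_ltn.
  have cE : letter s k.-1 = letter r k.-1 by apply: eq_lt; lia.
  have := topc; rewrite eqF !mem_tops cE inordK ?letter_ltn //.
  rewrite pos_letter ?prednK //; last by lia.
  case/andP=> _ lt_rc.
  move: topc; rewrite mem_tops inordK ?letter_ltn // pos_letter ?prednK //; last by lia.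
  case/andP=> _ lt_sc.
  have := later s r eq_lt ltac:(lia); rewrite -/l => lt_kp.
  have := eqa l; rewrite !stat312_downs (@downs_split s l 0 k) ?(ltnW lt_kp) //.
  have -> : pos r l = k :> nat by rewrite pos_letter.
  case: k {later} k_gt0 le_kn eq_lt lt_sr l lE cE lt_rc lt_sc lt_kp => //=.
  move=> k _ le_kn eq_lt lt_sr l lE cE lt_rc lt_sc lt_kp.
  by rewrite !downsS (@downs_eq_prefix s r) //; lia.
move=> not_top; set l : 'I_n.+1 := inord (letter s k).
have lE : l = letter s k :> nat by rewrite inordK // letter_ltn.
have pE : pos s l = k :> nat by rewrite pos_letter.
have not_bot : ~~ ((0 < k) && (l < letter s k.-1)).
  apply: contra not_top => /andP[k_gt0 lt_lc]; rewrite k_gt0 mem_tops.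
  rewrite inordK ?letter_ltn // pos_letter ?prednK //; last by lia.
  by rewrite le_kn -lE.
have : l \notin descent_bottoms r by rewrite -eqF' mem_bottoms pE.
have := later r s (fun i lt_ik => esym (eq_lt i lt_ik)) ltac:(lia).
rewrite -/l => lt_kp; rewrite mem_bottoms (leq_ltn_trans _ lt_kp) //= => not_bot_r.
have letter_p := letter_pos r l; have p_n := pos_le r l.
case: (ltngtP k (pos r l).-1) => [lt_kp'||eq_kp']; [|lia|]; last first.
  by move: not_bot_r; rewrite -eq_kp'; lia.
(* The extra descent of [r] over [l] takes place between [k] and [pos r l]. *)
have [j [le_kj lt_jp Qj Qj']] := @exists_switch (fun i => l < letter r i) k (pos r l).-1
  lt_kp' ltac:(lia) not_bot_r.
have := @letter_eq _ r j.+1 l ltac:(lia) => ne_j.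
have := eqa l; rewrite !stat312_downs pE (@downs_split r l 0 k) ?(ltnW lt_kp) //.
have : downs s l 0 k <= downs r l 0 k.
  case: k {later not_top} le_kn eq_lt lt_sr l lE {letter_p} pE not_bot not_bot_r lt_kp
    p_n lt_kp' le_kj lt_jp Qj Qj' ne_j => //=.
    by move=> *; rewrite /downs !big_geq.
  move=> k le_kn eq_lt lt_sr l lE *.
  by rewrite !downsS (@downs_eq_prefix s r) //; lia.
have jk : k <= j <= pos r l by rewrite le_kj; lia.
have jj : j <= j.+1 <= pos r l by lia.
have Qj1 : letter r j.+1 < l < letter r j by move: Qj Qj' ne_j lt_jp; clear; lia.
rewrite (@downs_split r l k j) // (@downs_split r l j j.+1) //.
have -> : downs r l j j.+1 = 1 by rewrite /downs big_nat1 Qj1.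
clear; lia.
Qed.

(** The word is rebuilt from left to right from these data. *)
Theorem stat312_determines s r :
  descent_tops s = descent_tops r -> descent_bottoms s = descent_bottoms r ->
  stat312_at s =1 stat312_at r -> s = r.
Proof.
move=> eqF eqF' eqa.
have eq_letter k : k <= n -> letter s k = letter r k.
  elim/ltn_ind: k => k IH le_kn.
  have eq_lt i : i < k -> letter s i = letter r i by move=> lt_ik; apply: IH; lia.
  apply/eqP; rewrite eqn_leq.
  rewrite (@no_first_difference r s) ?(@no_first_difference s r) //.
  by move=> i lt_ik; rewrite eq_lt.
apply/permP => i; apply/val_inj; rewrite /= -!letter_ord eq_letter //.
by rewrite -ltnS.
Qed.
End Injectivity.

(** * Greedy choices in sorted sequences *)

Section SortedCount.
Variables (T : eqType) (lt : rel T).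
Hypotheses (lt_trans : transitive lt) (lt_irr : irreflexive lt).

Lemma nth_sorted_lt d (r : seq T) i j : sorted lt r -> i < size r -> j < size r ->
  lt (nth d r i) (nth d r j) = (i < j).
Proof.
move=> srt ir jr; have mono := sorted_ltn_nth lt_trans d srt.
case: (ltngtP i j) => [lt_ij|lt_ji|->]; last exact: lt_irr.
  by apply: mono.
by apply/negP => /lt_trans/(_ (mono _ _ jr ir lt_ji)); rewrite lt_irr.
Qed.

Lemma count_lt_nth d (r : seq T) k : sorted lt r -> k < size r ->
  count (fun x => lt x (nth d r k)) r = k.
Proof.
move=> srt kr; pose before x := lt x (nth d r k).
have -> : count before r = count before (take k r) + count before (drop k r).
  by rewrite -count_cat cat_take_drop.
have /eqP-> : count before (drop k r) == 0.
  rewrite -leqn0 leqNgt -has_count; apply/(has_nthP d) => -[i].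
  by rewrite size_drop nth_drop /before => ilt; rewrite nth_sorted_lt //; lia.
have /eqP-> : count before (take k r) == size (take k r).
  rewrite -all_count; apply/(all_nthP d) => i; rewrite size_takel ?(ltnW kr) // => ik.
  by rewrite nth_take // /before nth_sorted_lt // (ltn_trans ik).
by rewrite size_takel ?(ltnW kr) // addn0.
Qed.

Lemma mem_take_index (r : seq T) i j : sorted lt r -> j \in r ->
  (i \in take (index j r) r) = (i \in r) && lt i j.
Proof.
move=> srt jr; have jsz : index j r < size r by rewrite index_mem.
apply/idP/andP => [ij|[ir lt_ij]].
  split; first exact: mem_take ij.
  have [k] := nthP j ij; rewrite size_takel ?(ltnW jsz) // => kj.
  by rewrite nth_take // -{2}(nth_index j jr) => <-; rewrite nth_sorted_lt // (ltn_trans kj).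
move: lt_ij; have isz : index i r < size r by rewrite index_mem.
rewrite -{1}(nth_index j ir) -{2}(nth_index j jr) nth_sorted_lt // => lt_ij.
by apply/(nthP j); exists (index i r); rewrite ?size_takel ?nth_take ?nth_index // ltnW.
Qed.
End SortedCount.

Section Greedy.
Variables (T : eqType) (ltj ltx : rel T).
Hypotheses (ltj_trans : transitive ltj) (ltj_irr : irreflexive ltj).
Hypotheses (ltx_trans : transitive ltx) (ltx_irr : irreflexive ltx).
Variables (js xs : seq T) (a : T -> nat) (P : rel T).
Hypotheses (js_sorted : sorted ltj js) (xs_sorted : sorted ltx xs).

Let pick j (ys : seq T) := nth j [seq x <- xs | P j x && (x \notin ys)] (a j).
Let f j := nth j (greedy pick js) (index j js).

Lemma size_greedy (pk : T -> seq T -> T) r : size (greedy pk r) = size r.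
Proof.
elim/last_ind: r => // r j IH; rewrite /greedy foldl_rcons !size_rcons.
by congr _.+1.
Qed.

Lemma take_greedy (pk : T -> seq T -> T) r i :
  take i (greedy pk r) = greedy pk (take i r).
Proof.
elim/last_ind: r => // r j IH; rewrite {1}/greedy foldl_rcons -/(greedy pk r).
case: (leqP i (size r)) => [le_ir|lt_ri].
  by rewrite -!cats1 !takel_cat ?size_greedy.
by rewrite !take_oversize ?size_rcons ?size_greedy // /greedy foldl_rcons.
Qed.

Lemma nth_greedy (pk : T -> seq T -> T) d r i : i < size r ->
  nth d (greedy pk r) i = pk (nth d r i) (greedy pk (take i r)).
Proof.
move=> lt_ir; rewrite -(nth_take d (ltnSn i)) take_greedy (take_nth d) //.
rewrite {1}/greedy foldl_rcons -/(greedy pk _) nth_rcons size_greedy size_takel ?ltnn ?eqxx //.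
exact: ltnW.
Qed.

Let js_uniq : uniq js. Proof. exact (sorted_uniq ltj_trans ltj_irr js_sorted). Qed.
Let xs_uniq : uniq xs. Proof. exact (sorted_uniq ltx_trans ltx_irr xs_sorted). Qed.

Lemma greedyE : greedy pick js = map f js.
Proof.
case: js js_uniq @f => [|d r] //; set q := d :: r => uq g.
apply: (@eq_from_nth _ d) => [|i]; rewrite size_greedy ?size_map // => iq.
rewrite (nth_map d) // /g index_uniq //; apply: set_nth_default.
by rewrite size_greedy.
Qed.

Lemma greedy_rec j : j \in js -> f j = pick j (map f (take (index j js) js)).
Proof.
move=> jin; have -> : f j = pick j (greedy pick (take (index j js) js)).
  by rewrite /f nth_greedy ?index_mem // nth_index.
by rewrite -take_greedy greedyE map_take.
Qed.

Hypothesis enough : forall j, j \in js -> index j js + a j < count (P j) xs.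

(** As more than [a j] elements remain after the [index j js] earlier choices, no
    choice falls back to the default value. Then the element chosen for [j] is
    the one that has exactly [a j] still available elements before it in [xs]. *)
Lemma greedy_spec j : j \in js ->
  [/\ f j \in xs, P j (f j), (forall i, i \in js -> ltj i j -> f i != f j)
  & count (fun x => [&& ltx x (f j), P j x &
            ~~ has (fun i => ltj i j && (f i == x)) js]) xs = a j].
Proof.
move=> jin; set ys := map f (take (index j js) js).
pose r := [seq x <- xs | P j x && (x \notin ys)].
have fE : f j = nth j r (a j) by rewrite greedy_rec.
have r_sorted : sorted ltx r by apply: sorted_filter.
have lt_a : a j < size r.
  have := enough jin.
  have : count (P j) xs <= size r + count (mem ys) xs.
    rewrite size_filter -count_predUI; apply: leq_trans (leq_addr _ _).
    by apply: sub_count => x /= ->; case: (x \in ys).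
  have : count (mem ys) xs <= index j js.
    have jsz := index_size j js.
    rewrite -size_filter -[leqRHS](size_takel jsz) -[leqRHS](size_map f).
    apply: uniq_leq_size; first exact: filter_uniq.
    by move=> x; rewrite mem_filter => /andP[].
  lia.
have : f j \in r by rewrite fE mem_nth.
rewrite mem_filter => /andP[/andP[Pj nys] fxs].
have ysE x : (x \in ys) = has (fun i => ltj i j && (f i == x)) js.
  apply/mapP/hasP => [[i]|[i iin /andP[lt_ij /eqP<-]]].
    rewrite (mem_take_index ltj_trans ltj_irr) // => /andP[iin lt_ij] ->.
    by exists i; rewrite ?lt_ij ?eqxx.
  by exists i; rewrite // (mem_take_index ltj_trans ltj_irr) // iin.
split=> // [i iin lt_ij|].
  by apply: contraNneq nys => <-; rewrite ysE; apply/hasP; exists i; rewrite ?lt_ij ?eqxx.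
rewrite -[RHS](count_lt_nth ltx_trans ltx_irr j r_sorted lt_a) -fE count_filter.
by apply: eq_count => x /=; rewrite ysE.
Qed.
End Greedy.

(** * Arc diagram of the image under PhiSZ *)

Section Sets.
Variable m : nat.
Implicit Types (A : {set 'I_m}).

Lemma enum_sorted A : sorted (fun x y : 'I_m => x < y) (enum A).
Proof.
rewrite /enum_mem; apply: sorted_filter; first by move=> y x z; apply: ltn_trans.
by rewrite -(@sorted_map _ _ val ltn) -?enumT val_enum_ord iota_ltn_sorted.
Qed.

Lemma rev_enum_sorted A : sorted (fun x y : 'I_m => y < x) (rev (enum A)).
Proof. by rewrite rev_sorted enum_sorted. Qed.

Lemma count_enum A (p : pred 'I_m) : count p (enum A) = #|[set x in A | p x]|.
Proof.
rewrite -size_filter cardE; apply/perm_size/uniq_perm; last first.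
- by move=> x; rewrite mem_filter !mem_enum inE andbC.
- exact: enum_uniq.
- exact/filter_uniq/enum_uniq.
Qed.

Lemma card_ge_ord j : j <= m -> #|[set x : 'I_m | j <= x]| = m - j.
Proof.
move=> le_jm; rewrite -sum1dep_card -[RHS]muln1 -sum_nat_const_nat.
rewrite [RHS](@big_nat_widenl _ _ _ j 0) // big_mkord; exact: eq_bigl.
Qed.

Lemma card_compl_ge A j : j <= m ->
  #|[set x in ~: A | j <= x]| + #|A| = m - j + #|[set x in A | x < j]|.
Proof.
move=> le_jm; rewrite -card_ge_ord //; set ge := [set x : 'I_m | j <= x].
have -> : [set x in ~: A | j <= x] = ge :\: A by apply/setP => x; rewrite !inE.
have -> : [set x in A | x < j] = A :\: ge.
  by apply/setP => x; rewrite !inE ltnNge andbC.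
by have := cardsID ge A; have := cardsID A ge; rewrite (setIC ge A) /reverse_coercion; lia.
Qed.
End Sets.

Lemma eq_greedy (T : Type) (pk pk' : T -> seq T -> T) (r : seq T) :
  (forall j ys, pk j ys = pk' j ys) -> greedy pk r = greedy pk' r.
Proof.
move=> E; elim/last_ind: r => // r j IH.
by rewrite /greedy !foldl_rcons -/(greedy pk r) -/(greedy pk' r) IH E.
Qed.

Section PhiSZ.
Variables (n : nat) (s : 'S_n.+1).
Local Notation F := (descent_tops s).
Local Notation F' := (descent_bottoms s).
Implicit Types (i j x : 'I_n.+1).
Local Notation f := (PhiSZ_fun s).

(** Besides the descents over [j], of which at least [stat312_at s j] exist, the
    descent starting at [j] has its bottom below [j]; the descents with a
    smaller top account for the choices made before. *)
Lemma enough_bottoms j : j \in F ->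
  index j (enum F) + stat312_at s j < count (fun x => x < j) (rev (enum F')).
Proof.
move=> jF; have := spanning_tops_bottoms s j; have := stat312D231 s j.
rewrite count_rev count_enum.
have -> : [set x in F | x <= j] = j |: [set x in F | x < j].
  apply/setP => x; rewrite !inE leq_eqVlt val_eqE.
  by case: eqP => [->|]; rewrite ?jF.
rewrite cardsU1 !inE ltnn andbF -count_enum.
have je : j \in enum F by rewrite mem_enum.
have := @count_lt_nth _ (fun x y : 'I_n.+1 => x < y) _ _ j (enum F) (index j (enum F)).
rewrite nth_index // => ->; last by rewrite index_mem.
- lia.
- by move=> y x z; apply: ltn_trans.
- by move=> x; apply: ltnn.
- exact: enum_sorted.
Qed.

(** As tops and bottoms are equally many, counting the complements from above
    gives the same surplus as for the tops: the letter [j] is itself not a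
    descent top, which provides the one extra candidate. *)
Lemma enough_nonbottoms j : j \notin F ->
  index j (rev (enum (~: F))) + stat312_at s j
    < count (fun x : 'I_n.+1 => j <= x) (enum (~: F')).
Proof.
move=> jG; have := spanning_tops_bottoms s j; have := stat312D231 s j.
rewrite count_enum.
have je : j \in rev (enum (~: F)) by rewrite mem_rev mem_enum inE.
have := @count_lt_nth _ (fun x y : 'I_n.+1 => y < x) _ _ j
  (rev (enum (~: F))) (index j (rev (enum (~: F)))).
rewrite nth_index // => idx; rewrite -{}[index _ _]idx; first last.
- by rewrite index_mem.
- exact: rev_enum_sorted.
- by move=> x; apply: ltnn.
- by move=> y x z h1 h2; apply: ltn_trans h1.
rewrite count_rev count_enum.
have := @card_compl_ge _ F j.+1 (ltn_ord j).
have := @card_compl_ge _ F' j (ltnW (ltn_ord j)).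
have := card_tops_bottoms s; have := ltn_ord j.
have -> : [set x in F | x < j.+1] = [set x in F | x <= j] by [].
lia.
Qed.

Let ltI_trans : transitive (fun x y : 'I_n.+1 => x < y).
Proof. by move=> y x z; apply: ltn_trans. Qed.
Let gtI_trans : transitive (fun x y : 'I_n.+1 => y < x).
Proof. by move=> y x z lt_yx lt_zy; apply: ltn_trans lt_yx. Qed.
Let ltI_irr : irreflexive (fun x y : 'I_n.+1 => x < y).
Proof. by move=> x; apply: ltnn. Qed.

Lemma PhiSZ_fun_top j : j \in F -> [/\ f j \in F', f j < j,
  (forall i, i \in F -> i < j -> f i != f j) &
  stat312_at s j = #|[set x in F' | [&& f j < x, x < j &
     ~~ has (fun i : 'I_n.+1 => (i < j) && (f i == x)) (enum F)]]|].
Proof.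
move=> jF.
pose pick (j : 'I_n.+1) (ys : seq 'I_n.+1) :=
  nth j [seq x : 'I_n.+1 <- rev (enum F') | (x < j) && (x \notin ys)] (stat312_at s j).
have fE i : i \in F -> f i = nth i (greedy pick (enum F)) (index i (enum F)).
  move=> iF; rewrite /PhiSZ_fun iF; congr (nth _ _ _); apply: eq_greedy => k ys.
  by rewrite /pickF /pick filter_rev.
have enough i : i \in enum F ->
    index i (enum F) + stat312_at s i < count (fun x => x < i) (rev (enum F')).
  by rewrite mem_enum; apply: enough_bottoms.
have je : j \in enum F by rewrite mem_enum.
have [] := @greedy_spec _ _ _ ltI_trans ltI_irr gtI_trans ltI_irr _ _ (stat312_at s)
  (fun j x : 'I_n.+1 => x < j) (enum_sorted F) (rev_enum_sorted F') enough j je.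
rewrite -/pick -(fE _ jF) mem_rev mem_enum => fj1 fj2 fj3 fj4; split=> //.
  by move=> i iF lt_ij; rewrite fE //; apply: fj3; rewrite ?mem_enum.
rewrite -[LHS]fj4 count_rev count_enum; apply: eq_card => x; rewrite !inE.
congr [&& _, _, _ & ~~ _]; apply: eq_in_has => i; rewrite mem_enum => iF.
by rewrite -/pick -fE.
Qed.

Lemma PhiSZ_fun_nontop j : j \notin F -> [/\ f j \notin F', j <= f j,
  (forall i, i \notin F -> j < i -> f i != f j) &
  stat312_at s j = #|[set x in ~: F' | [&& x < f j, j <= x &
     ~~ has (fun i : 'I_n.+1 => (j < i) && (f i == x)) (rev (enum (~: F)))]]|].
Proof.
move=> jG; pose js := rev (enum (~: F)).
pose pick (j : 'I_n.+1) (ys : seq 'I_n.+1) :=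
  nth j [seq x : 'I_n.+1 <- enum (~: F') | (j <= x) && (x \notin ys)] (stat312_at s j).
have mem_js i : (i \in js) = (i \notin F) by rewrite mem_rev mem_enum inE.
have fE i : i \notin F -> f i = nth i (greedy pick js) (index i js).
  by move=> iG; rewrite /PhiSZ_fun (negPf iG).
have enough i : i \in js ->
    index i js + stat312_at s i < count (fun x : 'I_n.+1 => i <= x) (enum (~: F')).
  by rewrite mem_js; apply: enough_nonbottoms.
have je : j \in js by rewrite mem_js.
have [] := @greedy_spec _ _ _ gtI_trans ltI_irr ltI_trans ltI_irr _ _ (stat312_at s)
  (fun j x : 'I_n.+1 => j <= x) (rev_enum_sorted _) (enum_sorted _) enough j je.
rewrite -/pick -(fE _ jG) mem_enum inE => fj1 fj2 fj3 fj4; split=> //.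
  by move=> i iG lt_ij; rewrite fE //; apply: fj3; rewrite ?mem_js.
rewrite -[LHS]fj4 count_enum; apply: eq_card => x; rewrite !inE.
congr [&& _, _, _ & ~~ _]; apply: eq_in_has => i; rewrite mem_js => iG.
by rewrite -/pick -fE.
Qed.

Lemma PhiSZ_fun_inj : injective f.
Proof.
move=> i j; case: (boolP (i \in F)) => iF; case: (boolP (j \in F)) => jF E.
- have [_ _ ni _] := PhiSZ_fun_top iF; have [_ _ nj _] := PhiSZ_fun_top jF.
  apply/val_inj/eqP; rewrite eqn_leq.
  apply/andP; split; rewrite leqNgt; apply/negP => lt; last by have := nj _ iF lt; rewrite E eqxx.
  by have := ni _ jF lt; rewrite E eqxx.
- have [iF' _ _ _] := PhiSZ_fun_top iF; have [jF' _ _ _] := PhiSZ_fun_nontop jF.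
  by rewrite E (negPf jF') in iF'.
- have [iF' _ _ _] := PhiSZ_fun_nontop iF; have [jF' _ _ _] := PhiSZ_fun_top jF.
  by rewrite E jF' in iF'.
have [_ _ ni _] := PhiSZ_fun_nontop iF; have [_ _ nj _] := PhiSZ_fun_nontop jF.
apply/val_inj/eqP; rewrite eqn_leq.
apply/andP; split; rewrite leqNgt; apply/negP => lt; last by have := ni _ jF lt; rewrite E eqxx.
by have := nj _ iF lt; rewrite E eqxx.
Qed.

Lemma PhiSZE j : PhiSZ s j = f j.
Proof.
rewrite /PhiSZ -pvalE val_insubd.
rewrite ifT ?ffunE //; apply/injectiveP => x y; rewrite !ffunE.
exact: PhiSZ_fun_inj.
Qed.

Local Notation t := (PhiSZ s).

Lemma PhiSZ_lt j : (t j < j) = (j \in F).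
Proof.
rewrite PhiSZE; case: (boolP (j \in F)) => [/PhiSZ_fun_top[]|/PhiSZ_fun_nontop[]] //.
by move=> _ le _ _; rewrite ltnNge le.
Qed.

Lemma PhiSZ_bottom j : (t j \in F') = (j \in F).
Proof.
rewrite PhiSZE; case: (boolP (j \in F)) => [/PhiSZ_fun_top[]|/PhiSZ_fun_nontop[]] //.
by move=> /negPf.
Qed.

End PhiSZ.

(** The arcs [i -> t i] with [t i < i] are drawn below the line and the others
    above it. Two arcs on the same side cross when exactly one end of each is
    under the other, and each crossing is attributed to one of its two arcs,
    the one with the smaller source for lower arcs and the one with the larger
    source for upper arcs. Weak inequalities let two upper arcs
    cross when they meet at the point [j]. *)
Definition crossing n (t : 'S_n) (j : 'I_n) : nat :=
  if t j < j then #|[set i : 'I_n | (j < i) && (t j < t i < j)]|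
  else #|[set i : 'I_n | (i < j) && (j <= t i < t j)]|.

(** Since [PhiSZ s] is a bijection that sends tops to bottoms, an element left
    available when [j] is treated is the image of a letter treated after [j].
    The available elements passed over by the choice for [j] are thus the
    targets of the arcs crossing the arc of [j]. *)
Lemma PhiSZ_crossing n (s : 'S_n.+1) j : crossing (PhiSZ s) j = stat312_at s j.
Proof.
set t := PhiSZ s; rewrite /crossing PhiSZ_lt -/t.
case: ifPn => jF.
  have [_ _ _ ->] := PhiSZ_fun_top jF; rewrite -!PhiSZE -/t.
  rewrite -[LHS](card_imset _ (@perm_inj _ t)); congr #|pred_of_set _|; apply/setP => x.
  apply/imsetP/idP => [[i]|].
    rewrite inE => /and3P[ji tji tij] ->; rewrite inE tji tij PhiSZ_bottom -PhiSZ_lt -/t.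
    rewrite (ltn_trans tij ji) /=; apply/hasPn => k _; rewrite -PhiSZE -/t.
    by apply/negP => /andP[kj /eqP/perm_inj ki]; rewrite ki in kj; lia.
  rewrite -(permKV t x); set i := (t^-1)%g x.
  rewrite inE PhiSZ_bottom => /and4P[iF tji tij /hasPn nh]; exists i => //.
  rewrite inE tji tij; have := nh i; rewrite mem_enum iF -PhiSZE eqxx andbT => /(_ isT).
  rewrite -leqNgt leq_eqVlt => /predU1P[/val_inj ij|->] //.
  by rewrite -ij ltnn in tji.
have [_ _ _ ->] := PhiSZ_fun_nontop jF; rewrite -!PhiSZE -/t.
rewrite -[LHS](card_imset _ (@perm_inj _ t)); congr #|pred_of_set _|; apply/setP => x.
apply/imsetP/idP => [[i]|].
  rewrite inE => /and3P[ij jti tij] ->; rewrite inE jti tij inE PhiSZ_bottom -PhiSZ_lt -/t.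
  rewrite -leqNgt (leq_trans (ltnW ij) jti) /=; apply/hasPn => k _; rewrite -PhiSZE -/t.
  by apply/negP => /andP[jk /eqP/perm_inj ki]; rewrite ki in jk; lia.
rewrite -(permKV t x); set i := (t^-1)%g x.
rewrite inE inE PhiSZ_bottom => /and4P[iG tij jti /hasPn nh]; exists i => //.
rewrite inE tij jti; have := nh i; rewrite mem_rev mem_enum inE iG -PhiSZE eqxx andbT.
move=> /(_ isT); rewrite -leqNgt leq_eqVlt => /predU1P[/val_inj ij|->] //.
by rewrite -ij ltnn in tij.
Qed.

(** The tops, the bottoms and the numbers [stat312_at] are all read off the arc
    diagram of [PhiSZ s]. *)
Theorem PhiSZ_inj n : injective (@PhiSZ n.+1).
Proof.
move=> s r E.
have eqF : descent_tops s = descent_tops r.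
  by apply/setP => j; rewrite -!PhiSZ_lt E.
apply: stat312_determines => // [|j]; last by rewrite -!PhiSZ_crossing E.
apply/setP => x; rewrite -(permKV (PhiSZ s) x); set y := ((PhiSZ s)^-1)%g x.
by rewrite PhiSZ_bottom E PhiSZ_bottom eqF.
Qed.

(** * Reflection of arc diagrams *)

Section Theta.
Variable n : nat.
Implicit Types (t : 'S_n.+1) (i j l : 'I_n.+1).

Lemma thetahatE t j : thetahat t (rev_ord j) = hat (t j).
Proof. by rewrite permE rev_ordK. Qed.

Lemma thetahat_invol : involutive (@thetahat n.+1).
Proof. by move=> t; apply/permP => j; rewrite !permE rev_ordK hatK. Qed.

Definition height t l := #|[set i : 'I_n.+1 | t i < l < i]|.

Lemma card_rev (A : pred 'I_n.+1) : #|[set i | A i]| = #|[set i | A (rev_ord i)]|.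
Proof.
rewrite -[LHS](card_imset _ (@rev_ord_inj n.+1)); congr #|pred_of_set _|.
apply/setP => i; rewrite [RHS]inE; apply/imsetP/idP => [[k]|Ai].
  by rewrite inE => Ak ->; rewrite rev_ordK.
by exists (rev_ord i); rewrite ?inE ?rev_ordK.
Qed.

Lemma hat_nat (a : 'I_n.+1) : hat a = (if a == n :> nat then n else n - a.+1) :> nat.
Proof. by rewrite hat_val eqSS subSS; case: eqP. Qed.

(** A bijection sends as many elements from below the level [l] to above it as
    in the other direction. *)
Lemma arcs_balance t l : #|[set i : 'I_n.+1 | i < l <= t i]| = #|[set i : 'I_n.+1 | t i < l <= i]|.
Proof.
pose src := [set i : 'I_n.+1 | i < l]; pose tgt := [set i : 'I_n.+1 | t i < l].
have eq_card_st : #|tgt| = #|src|.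
  rewrite -[LHS](card_imset _ (@perm_inj _ t)); congr #|pred_of_set _|.
  apply/setP => i; rewrite [RHS]inE; apply/imsetP/idP => [[k]|lt_il].
    by rewrite inE => ? ->.
  by exists ((t^-1)%g i); rewrite ?inE permKV.
have -> : [set i : 'I_n.+1 | i < l <= t i] = src :\: tgt.
  by apply/setP => i; rewrite !inE -leqNgt andbC.
have -> : [set i : 'I_n.+1 | t i < l <= i] = tgt :\: src.
  by apply/setP => i; rewrite !inE -leqNgt andbC.
by rewrite !cardsD eq_card_st setIC.
Qed.

Lemma perm_max_neq t i j : i != j -> t j = n :> nat -> t i < n.
Proof.
move=> ne_ij tj; have := ltn_ord (t i); rewrite ltnS leq_eqVlt => /predU1P[ti|//].
by case/negP: ne_ij; apply/eqP/(@perm_inj _ t)/val_inj; rewrite /= ti tj.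
Qed.

(** Reflection exchanges the lower and the upper arcs and keeps crossings, up to
    the shift by one that turns weak inequalities into strict ones. The arc to
    the maximum stays an upper arc, but it crosses every upper arc that passes
    over its source, and [arcs_balance] trades these for the lower arcs. *)
Lemma crossing_thetahat t j : crossing (thetahat t) (rev_ord j) = crossing t j.
Proof.
rewrite /crossing thetahatE hat_nat /= subSS.
have tjn := ltn_ord (t j); have jn := ltn_ord j.
case: (eqVneq (t j : nat) n) => [tj|tj].
  have -> : (n < n - j) = false by lia.
  have -> : (t j < j) = false by lia.
  have -> : [set i : 'I_n.+1 | (i < j) && (j <= t i < t j)] = [set i : 'I_n.+1 | i < j <= t i].
    apply/setP => i; rewrite !inE; case: ltnP => //= lt_ij.
    have := @perm_max_neq t i j _ tj; rewrite -val_eqE /= neq_ltn lt_ij => /(_ isT); lia.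
  rewrite arcs_balance card_rev; apply: eq_card => i; rewrite !inE thetahatE hat_nat /=.
  have := ltn_ord i; have := ltn_ord (t i).
  case: (eqVneq i j) => [->|ne_ij]; first by rewrite tj eqxx; lia.
  by have lt_tn := perm_max_neq ne_ij tj; move: ne_ij; rewrite (ltn_eqF lt_tn) -val_eqE /=; lia.
have -> : (n - (t j).+1 < n - j) = ~~ (t j < j) by lia.
case: (ltnP (t j) j) => tjj /=; rewrite card_rev; apply: eq_card => i;
  rewrite !inE thetahatE hat_nat /=;
  have := ltn_ord i; have := ltn_ord (t i); case: eqP; lia.
Qed.

(** The target of the reflected arc is shifted by one, so [l] goes to the
    reflection of [l + 1], and an arc ending there is lower exactly when the arc
    ending at [l] is upper. *)
Lemma thetahat_drop t l (l' : 'I_n.+1) : l' = l.+1 :> nat ->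
  (thetahat t ((thetahat t)^-1 (rev_ord l'))%g < (thetahat t)^-1 (rev_ord l'))%g
  = ~~ (t (t^-1 l) < t^-1 l)%g.
Proof.
move=> l'E; have -> : rev_ord l' = thetahat t (rev_ord (t^-1 l)%g).
  apply/val_inj => /=; rewrite thetahatE permKV hat_nat l'E.
  have := ltn_ord l'; case: eqP; lia.
rewrite permK thetahatE permKV hat_nat /=.
have := ltn_ord l'; have := ltn_ord (t^-1 l)%g; case: eqP; lia.
Qed.

(** The lower arcs over the reflection of [l] come from the upper arcs with
    [i < l <= t i], except the arc to the maximum. There are as many of those as
    lower arcs with [t i < l <= i], among which only the arc of [l] itself does
    not pass over [l]. *)
Lemma height_thetahat t l :
  height (thetahat t) (rev_ord l) + (l <= t l) = height t l + (l <= t^-1 ord_max)%g.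
Proof.
set k := (t^-1)%g ord_max.
have tk : t k = n :> nat by rewrite permKV.
have card_split (A B : pred 'I_n.+1) j : A j -> ~~ B j ->
    (forall i, i != j -> A i = B i) -> #|[set i | A i]| = #|[set i | B i]| + 1.
  move=> Aj Bj AB; rewrite addnC.
  have -> : [set i | A i] = j |: [set i | B i].
    by apply/setP => i; rewrite !inE; case: (eqVneq i j) => [->|/AB].
  by rewrite cardsU1 inE Bj.
have e1 : #|[set i : 'I_n.+1 | t i < l <= i]| = height t l + (t l < l).
  rewrite /height; case: (ltnP (t l) l) => tl.
    apply: (@card_split (fun i => t i < l <= i) (fun i => t i < l < i) l).
    - by rewrite tl leqnn.
    - by rewrite ltnn andbF.
    by move=> i; rewrite -val_eqE /=; lia.
  rewrite addn0; apply: eq_card => i; rewrite !inE.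
  by case: (eqVneq i l) => [->|]; rewrite -?val_eqE /=; lia.
have e2 : #|[set i : 'I_n.+1 | i < l <= t i]|
    = height (thetahat t) (rev_ord l) + (k < l).
  rewrite /height [in RHS]card_rev; have ln := ltn_ord l; case: (ltnP k l) => kl.
    apply: (@card_split (fun i => i < l <= t i)
      (fun i => thetahat t (rev_ord i) < rev_ord l < rev_ord i) k) => [||i ne].
    - by rewrite kl tk; lia.
    - by rewrite thetahatE hat_nat tk eqxx /=; lia.
    have := perm_max_neq ne tk; rewrite thetahatE hat_nat /= => ti.
    by have := ltn_ord i; rewrite (ltn_eqF ti); lia.
  rewrite addn0; apply: eq_card => i; rewrite !inE thetahatE hat_nat /=.
  have := ltn_ord i; case: (eqVneq i k) => [->|ne]; first by rewrite tk eqxx; lia.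
  by have ti := perm_max_neq ne tk; rewrite (ltn_eqF ti); lia.
by have := arcs_balance t l; rewrite e1 e2; lia.
Qed.
End Theta.

(** * Transport of the statistics *)

Section Transport.
Variable n : nat.
Implicit Types (s : 'S_n.+1) (j l : 'I_n.+1).

Lemma mem_bottoms_drop s l :
  (l \in descent_bottoms s) = (PhiSZ s ((PhiSZ s)^-1 l) < (PhiSZ s)^-1 l)%g.
Proof. by rewrite PhiSZ_lt -PhiSZ_bottom permKV. Qed.

Lemma downs_height s l : downs s l 0 n = height (PhiSZ s) l.
Proof.
have := spanning_tops_bottoms s l; set t := PhiSZ s.
have -> : #|[set x in descent_bottoms s | x < l]|
    = height t l + #|[set x in descent_tops s | x <= l]|.
  have -> : [set x in descent_bottoms s | x < l]
      = t @: [set i : 'I_n.+1 | (t i < i) && (t i < l)].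
    apply/setP => x; apply/idP/imsetP => [|[i]].
      rewrite inE mem_bottoms_drop -/t => /andP[dr lt_xl].
      by exists (t^-1 x)%g; rewrite ?inE ?dr permKV.
    by rewrite !inE => /andP[ti lt_l] ->; rewrite PhiSZ_bottom -PhiSZ_lt ti.
  rewrite card_imset; last exact: perm_inj.
  rewrite -(cardsID [set i : 'I_n.+1 | l < i]) /height; congr (_ + _); apply: eq_card => i.
    by rewrite !inE; lia.
  by rewrite !inE -PhiSZ_lt -/t; lia.
by move/addIn.
Qed.

Lemma crossingD231 s l : crossing (PhiSZ s) l + stat231_at s l = height (PhiSZ s) l.
Proof. by rewrite PhiSZ_crossing stat312D231 downs_height. Qed.

Lemma height_nontop (t : 'S_n.+1) l : l <= t l -> height t l = #|[set i : 'I_n.+1 | i < l <= t i]|.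
Proof.
move=> le_lt; rewrite arcs_balance; apply: eq_card => i; rewrite !inE.
by case: (eqVneq i l) => [->|]; rewrite -?val_eqE /=; lia.
Qed.

(** Both letters are the largest non-top [j] with [stat231_at s j = 0], as the
    two inequalities show: the arc to the maximum is crossed by all arcs passing
    over its source, and any non-top beyond the last letter, resp. beyond the
    source of that arc, has a descent over it on its right. *)
Lemma last_letter_preim s : last_letter s = ((PhiSZ s)^-1)%g ord_max.
Proof.
set t := PhiSZ s; set k := (t^-1)%g ord_max; set z := last_letter s.
have tk : t k = n :> nat by rewrite permKV.
have zF : z \notin descent_tops s by rewrite mem_tops pos_last ltnn.
have stat_z : stat231_at s z = 0.
  by rewrite stat231_downs pos_last /downs big_geq.
have kn := ltn_ord k; have zn := ltn_ord z.
have kF : k \notin descent_tops s by rewrite -PhiSZ_lt -/t tk; lia.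
have le_zt : z <= t z by rewrite leqNgt PhiSZ_lt.
have le_kz : k <= z.
  (* All arcs passing over [k] cross the arc to the maximum. *)
  have stat_k : stat231_at s k = 0.
    have le_kt : k <= t k by rewrite tk; lia.
    have := crossingD231 s k; rewrite height_nontop // /crossing -/t ltnNge le_kt /= tk.
    have -> : #|[set i : 'I_n.+1 | (i < k) && (k <= t i < n)]|
        = #|[set i : 'I_n.+1 | i < k <= t i]|.
      apply: eq_card => i; rewrite !inE; case: ltnP => //= lt_ik.
      by rewrite (@perm_max_neq _ t i k _ tk) ?andbT // -val_eqE /= neq_ltn lt_ik.
    by rewrite -[RHS]addn0 => /addnI.
  by have := stat213_231 s k; rewrite kF stat_k -/z; lia.
apply/val_inj/eqP; rewrite /= eqn_leq le_kz andbT leqNgt; apply/negP => lt_kz.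
have := crossingD231 s z; rewrite stat_z addn0 height_nontop // /crossing PhiSZ_lt (negPf zF).
apply/eqP; rewrite neq_ltn proper_card //; apply/properP; split.
  by apply/subsetP => i; rewrite !inE => /andP[-> /andP[-> _]].
have := ltn_ord (t z) => tzn.
by exists k; rewrite !inE -/t tk lt_kz /=; lia.
Qed.

Lemma PhiSZ_phihat s : PhiSZ (phihat s) = thetahat (PhiSZ s).
Proof. by rewrite /phihat f_finv //; apply: PhiSZ_inj. Qed.

Lemma phihat_invol : involutive (@phihat n.+1).
Proof.
by move=> s; apply: (@PhiSZ_inj n); rewrite !PhiSZ_phihat thetahat_invol.
Qed.

Lemma stat312_at_phihat s l : stat312_at (phihat s) (rev_ord l) = stat312_at s l.
Proof. by rewrite -!PhiSZ_crossing PhiSZ_phihat crossing_thetahat. Qed.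

(** Both sides are a height minus the same crossing number, and the boundary
    terms of [height_thetahat] and [stat213_231] coincide because the last
    letter is the source of the arc to the maximum. *)
Lemma stat231_at_phihat s l : stat231_at (phihat s) (rev_ord l) = stat213_at s l.
Proof.
have := crossingD231 (phihat s) (rev_ord l); have := crossingD231 s l.
have := height_thetahat (PhiSZ s) l; have := stat213_231 s l.
rewrite PhiSZ_phihat crossing_thetahat last_letter_preim -PhiSZ_lt -leqNgt => e1 e2 e3 e4.
apply: (@addnI (crossing (PhiSZ s) l)); apply: (@addIn (l <= PhiSZ s l)).
by rewrite e4 e2 -e3 -!addnA e1.
Qed.

Lemma stat312_phihat s : stat312 (phihat s) = stat312 s.
Proof.
rewrite /stat312 (reindex_inj (@rev_ord_inj _)); apply: eq_bigr => l _.
exact: stat312_at_phihat.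
Qed.

Lemma stat231_phihat s : stat231 (phihat s) = stat213 s.
Proof.
rewrite /stat231 (reindex_inj (@rev_ord_inj _)); apply: eq_bigr => l _.
exact: stat231_at_phihat.
Qed.

Lemma stat213_phihat s : stat213 (phihat s) = stat231 s.
Proof. by rewrite -stat231_phihat phihat_invol. Qed.

(** Reflection sends the pair [l], [l'] to the pair [rev_ord l'], [rev_ord l],
    swaps the two values of [stat312_at] and complements the membership in the
    set of bottoms. The two inequalities of [baxterP] are exchanged. *)
Lemma baxter_phihat s : baxter s -> baxter (phihat s).
Proof.
move/baxterP => steps; apply/baxterP => l l' l'E.
have revE : rev_ord l = (rev_ord l').+1 :> nat by have := ltn_ord l'; rewrite /= l'E; lia.
have bottomE : (l \in descent_bottoms (phihat s)) = (rev_ord l' \notin descent_bottoms s).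
  by rewrite !mem_bottoms_drop PhiSZ_phihat -(thetahat_drop _ revE) rev_ordK.
have statE k : stat312_at (phihat s) k = stat312_at s (rev_ord k).
  by rewrite -[k in LHS]rev_ordK stat312_at_phihat.
have := steps _ _ revE; rewrite bottomE !statE.
by case: (_ \in _) => /=; lia.
Qed.
End Transport.

Import GRing.Theory.
Local Open Scope ring_scope.

Theorem theorem1p4 (n : nat) (n_ge1 : (1 <= n)%N) :
  (forall p : 'S_n, baxter p -> baxter (phihat p)) /\
  (forall (R : comNzRingType) (q r s : R),
     \sum_(p : 'S_n | baxter p)
        q ^+ stat312 p * r ^+ stat213 p * s ^+ stat231 p =
     \sum_(p : 'S_n | baxter p)
        q ^+ stat312 p * r ^+ stat231 p * s ^+ stat213 p).
Proof.
case: n n_ge1 => // n _; split=> [|R q r s]; first exact: baxter_phihat.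
rewrite [RHS](reindex_inj (can_inj (@phihat_invol n))).
apply: eq_big => p; last by rewrite stat312_phihat stat231_phihat stat213_phihat.
apply/idP/idP; first exact: baxter_phihat.
by move/baxter_phihat; rewrite phihat_invol.
Qed.
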